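(* Let $X$ be a locally compact Hausdorff connected space. If $\rho$ is a quasi-linear functional on $C_0(X)$ or on $C_c(X)$, then $\mu_\rho$ is a compact-finite topological measure on $X$. If $\|\rho\|<\infty$, then $\mu_\rho$ is finite with $\mu_\rho(X)\le\|\rho\|$.
   Context: $C_0(X)$, $C_c(X)$, $C_b(X)$ are the real-valued continuous functions on $X$ vanishing at infinity, with compact support, and bounded, respectively, with the uniform norm (all equal to $C(X)$ if $X$ is compact); $\operatorname{supp} f=\overline{\{f\neq0\}}$. Singly generated subalgebra: for $f\in C_b(X)$, $S(f)$ is the smallest uniformly closed subalgebra of $C_b(X)$ containing $f$ and, if $X$ is compact, also containing the constant $1$. (If $X$ is compact, $S(f)=\{\phi\circ f:\phi\in C(f(X))\}$; if $X$ is not compact and $f\in C_0(X)$ or $C_c(X)$, $S(f)=\{\phi\circ f:\phi\in C(\overline{f(X)}),\ \phi(0)=0\}$, which lies in $C_0(X)$, resp. $C_c(X)$.) Quasi-linear functional on $\mathcal B$ ($\mathcal B=C_0(X)$ or $C_c(X)$): a map $\rho:\mathcal B\to\mathbb R$ with $\rho(af)=a\rho(f)$ for $a\in\mathbb R$, $f\in\mathcal B$; $\rho(f+g)=\rho(f)+\rho(g)$ whenever $f,g\in S(h)$ for some $h\in\mathcal B$; and $\rho(f)\ge0$ whenever $f\ge0$. Its norm is $\|\rho\|=\sup\{\rho(f): f\in\mathcal B,\ 0\le f\le1\}\in[0,\infty]$. Topological measure on $X$: a set function $\mu$ from the open and closed subsets of $X$ to $[0,\infty]$, not identically $\infty$,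 such that (TM1) $\mu(A\sqcup B)=\mu(A)+\mu(B)$ whenever $A,B$ are disjoint and each of $A,B,A\sqcup B$ is compact or open; (TM2) $\mu(U)=\sup\{\mu(K):K\subseteq U \text{ compact}\}$ for $U$ open; (TM3) $\mu(F)=\inf\{\mu(U):U\supseteq F\text{ open}\}$ for $F$ closed. It is finite if $\mu(X)<\infty$, and compact-finite if $\mu(K)<\infty$ for all compact $K$. Set function $\mu_\rho$: $\mu_\rho(U)=\sup\{\rho(f): f\in C_c(X),\ 0\le f\le1,\ \operatorname{supp} f\subseteq U\}$ for $U$ open, and $\mu_\rho(F)=\inf\{\mu_\rho(U):F\subseteq U,\ U\text{ open}\}$ for $F$ closed. *)

(* Defs.v *)
From HB Require Import structures.
From mathcomp Require Export all_boot all_order all_algebra.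
From mathcomp Require Export all_classical all_reals all_analysis.
Export Order.TTheory GRing.Theory Num.Theory.
Export numFieldNormedType.Exports.

Set Implicit Arguments.
Unset Strict Implicit.
Unset Printing Implicit Defensive.

Local Open Scope classical_set_scope.
Local Open Scope ring_scope.

Definition supp (R : realType) (X : topologicalType) (f : X -> R) : set X :=
  closure [set x | f x != 0].

Definition Cb (R : realType) (X : topologicalType) : set (X -> R) :=
  [set f | continuous f /\ bounded_fun f].

Definition C0 (R : realType) (X : topologicalType) : set (X -> R) :=
  [set f | continuous f /\
           forall e : R, 0 < e -> compact [set x | e <= `|f x|]].

Definition Cc (R : realType) (X : topologicalType) : set (X -> R) :=
  [set f | continuous f /\ compact (supp f)].

(* Subalgebras need not be unital; the constant 1 is required only when X is
   compact. Being uniformly closed is stated in the space of all functions with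
   the topology of uniform convergence, in which Cb is itself closed and
   inherits the topology of the uniform norm. *)
Record closed_subalgebra (R : realType) (X : topologicalType)
    (A : set (X -> R)) : Prop := ClosedSubalgebra {
  subalgebra_Cb : A `<=` @Cb R X;
  subalgebraD : forall f g, A f -> A g -> A (f \+ g);
  subalgebraZ : forall (a : R) f, A f -> A (a \*o f);
  subalgebraM : forall f g, A f -> A g -> A (f \* g);
  subalgebra_closed : closed (A : set {uniform X -> R});
  subalgebra1 : compact [set: X] -> A (cst 1)
}.

Definition singly_generated (R : realType) (X : topologicalType)
    (f : X -> R) : set (X -> R) :=
  smallest (@closed_subalgebra R X) [set f].

(* A functional on B is represented by a total map on X -> R, whose values
   outside B are irrelevant; note that S(h) is included in B for h in B when
   B is C0 or Cc. *)
Record quasi_linear (R : realType) (X : topologicalType)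
    (B : set (X -> R)) (rho : (X -> R) -> R) : Prop := QuasiLinear {
  quasi_linearZ : forall (a : R) f, B f -> rho (a \*o f) = a * rho f;
  quasi_linearD : forall h f g, B h ->
    singly_generated h f -> singly_generated h g ->
    rho (f \+ g) = rho f + rho g;
  quasi_linear_ge0 : forall f, B f -> (forall x, 0 <= f x) -> 0 <= rho f
}.

Local Open Scope ereal_scope.

Definition ql_norm (R : realType) (X : topologicalType)
    (B : set (X -> R)) (rho : (X -> R) -> R) : \bar R :=
  ereal_sup [set (rho f)%:E | f in
    [set f | B f /\ (forall x, 0 <= f x <= 1)%R]].

(* A set function on the open and closed subsets of X is represented by a
   total map on set X; only its values on open sets and on closed sets are
   constrained. In a Hausdorff space compact sets are closed. *)
Record topological_measure (R : realType) (X : topologicalType)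
    (mu : set X -> \bar R) : Prop := TopologicalMeasure {
  tmeasure_ge0 : forall A, open A \/ closed A -> 0 <= mu A;
  tmeasure_proper : exists2 A, open A \/ closed A & mu A != +oo;
  tmeasureU : forall A B, A `&` B = set0 ->
    compact A \/ open A -> compact B \/ open B ->
    compact (A `|` B) \/ open (A `|` B) ->
    mu (A `|` B) = mu A + mu B;
  tmeasure_inner : forall U, open U ->
    mu U = ereal_sup [set mu K | K in [set K | compact K /\ K `<=` U]];
  tmeasure_outer : forall F, closed F ->
    mu F = ereal_inf [set mu U | U in [set U | open U /\ F `<=` U]]
}.

Definition tm_finite (R : realType) (X : topologicalType)
    (mu : set X -> \bar R) : Prop :=
  mu [set: X] < +oo.

Definition tm_compact_finite (R : realType) (X : topologicalType)
    (mu : set X -> \bar R) : Prop :=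
  forall K, compact K -> mu K < +oo.

Definition mu_open (R : realType) (X : topologicalType)
    (rho : (X -> R) -> R) (U : set X) : \bar R :=
  ereal_sup [set (rho f)%:E | f in
    [set f | [/\ @Cc R X f, (forall x, 0 <= f x <= 1)%R & supp f `<=` U]]].

Definition mu_closed (R : realType) (X : topologicalType)
    (rho : (X -> R) -> R) (F : set X) : \bar R :=
  ereal_inf [set mu_open rho U | U in [set U | open U /\ F `<=` U]].

(* The two formulas agree on clopen sets, see mu_rho_closedE. *)
Definition mu_rho (R : realType) (X : topologicalType)
    (rho : (X -> R) -> R) (A : set X) : \bar R :=
  if `[< open A >] then mu_open rho A else mu_closed rho A.

Lemma mu_rho_openE (R : realType) (X : topologicalType)
    (rho : (X -> R) -> R) (U : set X) :
  open U -> mu_rho rho U = mu_open rho U.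
Proof. by rewrite /mu_rho; case: asboolP. Qed.

Lemma mu_rho_closedE (R : realType) (X : topologicalType)
    (rho : (X -> R) -> R) (F : set X) :
  closed F -> mu_rho rho F = mu_closed rho F.
Proof.
move=> _; rewrite /mu_rho; case: asboolP => // oF.
apply/eqP; rewrite eq_le; apply/andP; split; last first.
  by apply: ereal_inf_lbound; exists F => //=; split.
apply/le_ereal_inf_tmp => _ [U [oU FU] <-].
apply: ereal_sup_le => _ [f [fc f01 sf] <-].
by exists f => //; split => //; exact: subset_trans FU.
Qed.

(* Main.v *)
(* The closed algebra generated by [h] contains [|h - c| - |c|], by polynomial
   approximation of the absolute value, hence also [(h - c)^+] for [c >= 0]. So
   [rho] is additive on two nonnegative functions [f], [g] with [f g = 0], which
   are the positive and negative parts of [f - g], and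
   [rho (f - g) = rho f - rho g] whenever [f = 1] where [g <> 0], because then
   [g = (f + g - 1)^+].
   With Urysohn functions these two facts give additivity of the set function on
   disjoint open sets and, for [K] compact inside [W] open, the identity
   [mu W = mu K + mu (W \ K)]; the other cases of additivity are formal
   consequences, and inner regularity holds since [rho f <= mu (supp f)]. *)
Require Import Defs.
From mathcomp Require Import ring lra.

Set Implicit Arguments.
Unset Strict Implicit.
Unset Printing Implicit Defensive.

Local Open Scope classical_set_scope.
Local Open Scope ring_scope.

(** * Polynomial approximation of the absolute value inside closed subalgebras *)

Section PolynomialCalculus.
Variable R : realType.

(* The iteration [p <- p + (t^2 - p^2) / 2] increases to [`|t|] on [-1, 1];
   the last inequality bounds the error after [n] steps by [2 / n]. *)
Lemma abs_poly_approx1 (n : nat) : exists p : {poly R}, forall t : R,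
  `|t| <= 1 -> 0 <= p.[t] <= `|t| /\
    (`|t| - p.[t]) * (1 + n%:R * (`|t| / 2)) <= `|t|.
Proof.
elim: n => [|n [p IH]].
  exists 0 => t t1; rewrite horner0 mul0r addr0 mulr1 subr0.
  by rewrite !lexx normr_ge0.
exists (p + 2^-1 *: ('X ^+ 2 - p ^+ 2)) => t t1.
have [/andP[p0 pt] H] := IH _ t1.
rewrite hornerD hornerZ hornerD hornerN !horner_exp hornerX.
rewrite -(real_normK (num_real t)).
have t0 := normr_ge0 t.
move: (`|t|) (p.[t]) t0 t1 p0 pt H => s q s0 s1 q0 qs H.
have n0 : 0 <= n%:R :> R by rewrite ler0n.
split; first by apply/andP; split; nra.
apply: le_trans H; rewrite -[n.+1%:R]natr1.
have -> : s - (q + 2^-1 * (s ^+ 2 - q ^+ 2)) = (s - q) * (1 - (s + q) / 2).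
  by field.
rewrite -mulrA ler_wpM2l ?subr_ge0//.
apply: (@le_trans _ _ ((1 - s / 2) * (1 + (n%:R + 1) * (s / 2)))).
  by rewrite ler_wpM2r//; [nra|lra].
by nra.
Qed.

Lemma abs_poly_approx (M e : R) : 0 < M -> 0 < e ->
  exists p : {poly R}, forall t, `|t| <= M -> `|p.[t] - `|t| | <= e.
Proof.
move=> M0 e0.
(* Rescaling from [[-1, 1]] to [[-M, M]] turns the error [2 / n] into [2 M / n], which is below [e]
   for this [n]. *)
pose n := (Num.truncn (2 * M / e)).+1.
have n0 : 0 < n%:R :> R by rewrite ltr0n.
have nMe : 2 * M / e < n%:R by rewrite /n truncnS_gt.
have [p hp] := abs_poly_approx1 n.
exists (M *: (p \Po (M^-1 *: 'X))) => t tM.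
rewrite !hornerE horner_comp !hornerE.
have [|/andP[p0 pt] H] := hp (M^-1 * t).
  by rewrite normrM gtr0_norm ?invr_gt0// mulrC ler_pdivrMr// mul1r.
have -> : `|t| = M * `|M^-1 * t|.
  by rewrite normrM gtr0_norm ?invr_gt0// mulrA divff ?mul1r// gt_eqF.
move: (`|_ * t|) p0 pt H (normr_ge0 (M^-1 * t)) => s p0 pt H s0.
rewrite -mulrBr normrM (gtr0_norm M0) distrC ger0_norm ?subr_ge0//.
move: p.[_] p0 pt H => q q0 qs H.
(* The bound [H] yields [(s - q) n <= 2] only after division by [s]; at [s = 0] the squeeze
   [0 <= q <= s] suffices. *)
have [s_eq0|s_neq0] := eqVneq s 0.
  have -> : s - q = 0 by lra.
  by rewrite mulr0 ltW.
have s_gt0 : 0 < s by rewrite lt_neqAle eq_sym s_neq0.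
have {}H : (s - q) * n%:R <= 2.
  rewrite -(ler_pM2r s_gt0).
  have : (s - q) * (1 + n%:R * (s / 2)) = (s - q) + (s - q) * n%:R * s / 2.
    by field.
  by lra.
move: nMe; rewrite ltr_pdivrMr// => nMe.
rewrite -(ler_pM2r n0) -mulrA.
apply: (@le_trans _ _ (M * 2)); first by rewrite ler_pM2l.
by lra.
Qed.

Variable X : topologicalType.
Implicit Types (A : set (X -> R)) (f g h : X -> R).

Lemma closed_subalgebra_uniform_lim A f : closed_subalgebra A ->
  (forall e : R, 0 < e -> exists2 g, A g & forall x, `|f x - g x| < e) -> A f.
Proof.
move=> cA Af; apply: (subalgebra_closed cA) => W /uniform_nbhs[E [entE EW]].
move: entE; rewrite -entourage_ballE => -[e /= e0 eE].
have [g Ag fg] := Af e e0.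
by exists g; split => //; apply: EW => y _; apply: eE; exact: fg.
Qed.

(** The constant term is removed because [A] may lack the constants. The induction on [p * 'X + c]
    uses [p(h) h = (p(h) - p(0)) h + p(0) h]. *)
Lemma closed_subalgebra_poly A h (p : {poly R}) : closed_subalgebra A ->
  A h -> A (fun x => p.[h x] - p.[0]).
Proof.
move=> cA Ah; elim/poly_ind: p => [|p c IH].
  rewrite (_ : (fun _ => _) = 0 \*o h); first exact: subalgebraZ.
  by apply/funext => x /=; rewrite !horner0 mul0r subrr.
rewrite (_ : (fun _ => _) =
    ((fun x => p.[h x] - p.[0]) \* h) \+ (p.[0] \*o h)).
  by apply: subalgebraD => //; [exact: subalgebraM | exact: subalgebraZ].
by apply/funext => x /=; rewrite !hornerE; ring.
Qed.

Lemma closed_subalgebra_abs A h (c : R) : closed_subalgebra A ->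
  A h -> A (fun x => `|h x - c| - `|c|).
Proof.
move=> cA Ah; apply: (closed_subalgebra_uniform_lim cA) => e e0.
have [_ /pinfty_ex_gt0[M M0 hM]] := subalgebra_Cb cA Ah.
have N0 : 0 < M + `|c| by rewrite ltr_wpDr.
(* Two errors add up, one at [h x - c] and one at [- c]; with [e / 3] each, the total stays strictly
   below [e]. *)
have [p hp] := abs_poly_approx N0 (divr_gt0 e0 (ltr0n R 3)).
exists (fun x => (p \Po ('X - c%:P)).[h x] - (p \Po ('X - c%:P)).[0]).
  exact: closed_subalgebra_poly.
move=> x; rewrite !horner_comp !hornerXsubC sub0r.
have hx : `|h x - c| <= M + `|c|.
  by rewrite (le_trans (ler_normB _ _))// lerD2r; exact: hM.
have h0 : `|- c| <= M + `|c| by rewrite normrN lerDr ltW.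
have := hp _ hx; have := hp _ h0; rewrite normrN !ler_distl ltr_norml.
by lra.
Qed.

(** From [max(a, 0) = (|a| + a) / 2] with [a = h - c]; for [c >= 0] the leftover constant [- c] is
    exactly the [- |c|] already available in [A]. *)
Lemma closed_subalgebra_pos A h (c : R) : closed_subalgebra A -> 0 <= c ->
  A h -> A (fun x => Num.max (h x - c) 0).
Proof.
move=> cA c0 Ah.
rewrite (_ : (fun _ => _) =
    2^-1 \*o ((fun x => `|h x - c| - `|c|) \+ h)).
  apply: subalgebraZ => //; apply: subalgebraD => //.
  exact: closed_subalgebra_abs.
by apply/funext => x /=; rewrite maxr_absE subr0 addr0 (ger0_norm c0); field.
Qed.

End PolynomialCalculus.

(** * Two situations in which a quasi-linear functional is additive *)

Section QuasiLinear.
Variables (R : realType) (X : topologicalType).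
Variables (B : set (X -> R)) (rho : (X -> R) -> R).
Hypothesis hrho : quasi_linear B rho.
Implicit Types f g h : X -> R.

Lemma quasi_linear0 f : B f -> rho (cst 0) = 0.
Proof.
move=> Bf; have := quasi_linearZ hrho 0 Bf.
rewrite mul0r => E; rewrite -[RHS]E; congr rho.
by apply/funext => x /=; rewrite mul0r.
Qed.

Lemma quasi_linearD_disjoint f g : B (f \- g) ->
  (forall x, 0 <= f x) -> (forall x, 0 <= g x) -> (forall x, f x * g x = 0) ->
  rho (f \+ g) = rho f + rho g.
Proof.
move=> Bfg f0 g0 fg0; apply: (quasi_linearD hrho Bfg) => A [cA] /(_ _ erefl) Ah.
  rewrite (_ : f = fun x => Num.max ((f \- g) x - 0) 0).
    exact: closed_subalgebra_pos.
  apply/funext => x /=; rewrite subr0.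
  have /eqP := fg0 x; rewrite mulf_eq0 => /orP[] /eqP E; rewrite E.
    by rewrite sub0r max_r// oppr_le0.
  by rewrite subr0 max_l.
rewrite (_ : g = fun x => Num.max ((-1 \*o (f \- g)) x - 0) 0).
  by apply: closed_subalgebra_pos => //; exact: subalgebraZ.
apply/funext => x /=; rewrite subr0 mulN1r opprB.
have /eqP := fg0 x; rewrite mulf_eq0 => /orP[] /eqP E; rewrite E.
  by rewrite subr0 max_l.
by rewrite sub0r max_r// oppr_le0.
Qed.

Lemma quasi_linearB f g : B (f \+ g) ->
  (forall x, 0 <= g x) -> (forall x, f x <= 1) ->
  (forall x, g x != 0 -> f x = 1) ->
  rho (f \- g) = rho f - rho g.
Proof.
move=> Bfg g0 f1 fg1.
have gE : g = fun x => Num.max ((f \+ g) x - 1) 0.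
  apply/funext => x /=; have [E|/fg1 ->] := eqVneq (g x) 0.
    by rewrite E addr0 max_r// subr_le0.
  by rewrite addrC addKr max_l.
have Sg A : closed_subalgebra A -> A (f \+ g) -> A g.
  by move=> cA Ah; rewrite gE; exact: closed_subalgebra_pos.
have fE : f = (f \- g) \+ g by apply/funext => x /=; rewrite subrK.
(* Additivity is applied inside the algebra of [f + g] to the splitting [f = (f - g) + g], where
   [f - g = (f + g) - 2 g]. *)
suff : rho ((f \- g) \+ g) = rho (f \- g) + rho g.
  by rewrite -fE => ->; rewrite addrK.
apply: (quasi_linearD hrho Bfg) => A [cA] /(_ _ erefl) Ah; last exact: Sg.
rewrite (_ : f \- g = (f \+ g) \+ (-2 \*o g)).
  by apply: subalgebraD => //; apply: subalgebraZ => //; exact: Sg.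
by apply/funext => x /=; ring.
Qed.

End QuasiLinear.

(** * Compactly supported Urysohn functions and separation of compact sets *)

Section LocallyCompact.
Variables (R : realType) (X : topologicalType).
Hypothesis (lcX : locally_compact [set: X]) (hX : hausdorff_space X).

Lemma supp_subset (f : X -> R) (F : set X) : closed F ->
  (forall x, ~ F x -> f x = 0) -> supp f `<=` F.
Proof.
move=> cF F0; rewrite [F in _ `<=` F](iffLR (closure_id F))//.
apply: closureS => x /= fx; apply: contrapT => /F0 E.
by move: fx; rewrite E eqxx.
Qed.

Lemma notin_supp (f : X -> R) (x : X) : ~ supp f x -> f x = 0.
Proof.
by move=> nfx; apply: contra_notP nfx => /eqP fx; exact: subset_closure.
Qed.

Lemma Cc_subset (f : X -> R) (K : set X) :
  continuous f -> compact K -> supp f `<=` K -> Cc f.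
Proof.
move=> cf cK fK; split => //.
exact: (subclosed_compact (@closed_closure _ _) cK fK).
Qed.

(** The one-point compactification is compact Hausdorff, hence normal, so [K] can be separated there
    from the complement of [U], which contains the point at infinity. *)
Lemma urysohn_Cc (K U : set X) : compact K -> open U -> K `<=` U ->
  exists (g : X -> R) (V : set X),
    [/\ Cc g, forall x, 0 <= g x <= 1, supp g `<=` U, open V & K `<=` V] /\
    (forall x, V x -> g x = 1).
Proof.
move=> cK oU KU.
pose Y : topologicalType := one_point_compactification X.
have hY : hausdorff_space Y := one_point_compactification_hausdorff lcX hX.
have cY : compact [set: Y] := one_point_compactification_compact.
have cS : continuous (Some : X -> Y).
  exact: one_point_compactification_some_continuous.
have clK : closed (Some @` K : set Y).
  apply: compact_closed => //; apply: continuous_compact => //.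
  exact: continuous_subspaceT.
have oSU : open (Some @` U : set Y).
  exact: one_point_compactification_open_some.
have UK0 : ~` (Some @` U : set Y) `&` Some @` K = set0.
  by apply/seteqP; split => // y [/= nUy [x Kx xy]]; apply: nUy; exists x; auto.
have [f [cf f01 f0 f1]] := (uniform_separatorP (R := R) _ _).1
  ((normal_separatorP (R := R)).1 (compact_normal hY cY)
    _ _ (open_closedC oSU) clK UK0).
(* The truncation makes [g] vanish where [f <= 1/3] and equal [1] where [f >= 2/3]. Thus the support
   lies in the closed set [1/3 <= f] inside [U], and [g = 1] on the open set [2/3 < f] around
   [K]. *)
pose g (x : X) : R := Num.min (Num.max (3 * f (Some x) - 1) 0) 1.
have g01 x : 0 <= g x <= 1.
  by rewrite /g le_min ler01 le_max lexx orbT/= ge_min lexx orbT.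
have cfS : continuous (f \o Some : X -> R).
  by move=> x; apply: continuous_comp; [exact: cS|exact: cf].
have cg : continuous g.
  move=> x; apply: (@continuous_min R X
      (fun x => Num.max (3 * f (Some x) - 1) 0) (fun=> 1)); last exact: cvg_cst.
  apply: (@continuous_max R X (fun x => 3 * f (Some x) - 1) (fun=> 0));
    last exact: cvg_cst.
  apply: (@cvgB R R^o); last exact: cvg_cst.
  by apply: cvgM; [exact: cvg_cst|exact: cfS].
pose C : set X := (f \o Some) @^-1` [set y | 1/3 <= y].
have cC : closed C.
  by apply: closed_comp; [move=> x _; exact: cfS | exact: closed_ge].
have sgC : supp g `<=` C.
  apply: supp_subset => // x /negP; rewrite -ltNge => fx.
  rewrite /g max_r; last by move: fx => /=; lra.
  by rewrite min_l.
have CU : C `<=` U.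
  move=> x Cx; apply: contrapT => nUx; have fx : 1/3 <= f (Some x) := Cx.
  have : f (Some x) = 0.
    by apply: f0; exists (Some x) => //= -[z Uz [zx]]; apply: nUx; rewrite -zx.
  by move: fx => /= /[swap] ->; lra.
have compC : compact C.
  have SC : compact (Some @` C : set Y).
    apply: (subclosed_compact _ cY) => //.
    rewrite (_ : Some @` C = f @^-1` [set y | 1/3 <= y]).
      by apply: closed_comp; [move=> ? _; exact: cf | exact: closed_ge].
    apply/seteqP; split => [_ [x Cx <-] //|[x|]] /= fx; first by exists x.
    have : f None = 0 by apply: f0; exists None => //= -[].
    by move: fx => /= /[swap] ->; lra.
  (* Compactness is pulled back along [Some]: a cluster point of the image filter is some [Some x],
     and neighbourhoods of [x] have neighbourhoods of [Some x] as images. *)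
  move=> F PF FC.
  have [_ [[x Cx <-] cl]] := SC (Some @ F) _
    (filterS (@preimage_image _ _ Some C) FC).
  exists x; split => // P Q FP Qx.
  have [_ [[p Pp <-] [q Qq [qp]]]] := cl (Some @` P) (Some @` Q)
    (filterS (@preimage_image _ _ Some P) FP)
    (@one_point_compactification_some_nbhs X x Q Qx).
  by exists p; split => //; rewrite -qp.
exists g, ((f \o Some) @^-1` [set y | 2/3 < y]); split; [split|] => //.
- exact: Cc_subset compC sgC.
- exact: subset_trans sgC CU.
- by apply: open_comp; [move=> x _; exact: cfS | exact: open_gt].
- move=> x Kx /=; have -> : f (Some x) = 1.
    by apply: f1; exists (Some x) => //; exists x.
  by lra.
- move=> x /= fx; rewrite /g max_l ?min_r//; lra.
Qed.

Lemma separate_compact (K L : set X) : compact K -> compact L ->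
  K `&` L = set0 -> exists U V : set X,
    [/\ open U, open V, K `<=` U, L `<=` V & U `&` V = set0].
Proof.
move=> cK cL KL0.
have oL : open (~` L) := closed_openC (compact_closed hX cL).
have cLK : K `<=` ~` L by apply/disjoints_subset.
have [g [V [[[cg cpg] g01 gL oV KV] g1]]] := urysohn_Cc cK oL cLK.
(* [g] is [1] on [V] and [0] off its support, and that support misses [L]. *)
exists V, (~` supp g); split => //.
- exact/closed_openC/closed_closure.
- by move=> x Lx /gL.
apply/seteqP; split => // x [/g1 gx /notin_supp].
by rewrite gx => /eqP; rewrite oner_eq0.
Qed.

Lemma open_precompact_nbhs (K : set X) : compact K ->
  exists W D : set X, [/\ open W, compact D, K `<=` W & W `<=` D].
Proof.
move=> cK; have [g [V [[[cg cpg] g01 gL oV KV] g1]]] :=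
  urysohn_Cc cK openT (@subsetT _ _).
exists V, (supp g); split => // x /g1 gx; apply: subset_closure => /=.
by rewrite gx oner_eq0.
Qed.

End LocallyCompact.

(** * Closure properties of the compactly supported functions *)

Section CompactSupport.
Variables (R : realType) (X : topologicalType).
Implicit Types f g : X -> R.

Lemma supp_subset2 (f g h : X -> R) :
  (forall x, f x = 0 -> g x = 0 -> h x = 0) -> supp h `<=` supp f `|` supp g.
Proof.
move=> fgh; apply: supp_subset; first by apply: closedU; exact: closed_closure.
by move=> x /not_orP[/notin_supp fx /notin_supp gx]; exact: fgh.
Qed.

Lemma Cc0 : @Cc R X (cst 0).
Proof.
apply: (@Cc_subset _ _ _ set0); first by move=> x; exact: cvg_cst.
  exact: compact0.
by apply: supp_subset => //; exact: closed0.
Qed.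

Lemma CcD f g : Cc f -> Cc g -> Cc (f \+ g).
Proof.
move=> [cf kf] [cg kg]; apply: (@Cc_subset _ _ _ (supp f `|` supp g)).
- by move=> x; apply: (@cvgD R R^o); [exact: cf|exact: cg].
- exact: compactU.
- by apply: supp_subset2 => x /= -> ->; rewrite addr0.
Qed.

Lemma CcB f g : Cc f -> Cc g -> Cc (f \- g).
Proof.
move=> [cf kf] [cg kg]; apply: (@Cc_subset _ _ _ (supp f `|` supp g)).
- by move=> x; apply: (@cvgB R R^o); [exact: cf|exact: cg].
- exact: compactU.
- by apply: supp_subset2 => x /= -> ->; rewrite subr0.
Qed.

Lemma CcM f g : Cc f -> Cc g -> Cc (f \* g).
Proof.
move=> [cf kf] [cg kg]; apply: (Cc_subset _ kf).
- by move=> x; apply: cvgM; [exact: cf|exact: cg].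
- apply: supp_subset => [|x /notin_supp fx]; first exact: closed_closure.
  by rewrite /= fx mul0r.
Qed.

Lemma Cc_C0 : @Cc R X `<=` @C0 R X.
Proof.
move=> f [cf kf]; split => // e e0.
apply: (subclosed_compact _ kf).
  apply: (@closed_comp _ _ (fun x => `|f x|) [set y | e <= y]).
    by move=> x _; apply: cvg_norm; exact: cf.
  exact: closed_ge.
move=> x /= ex; apply: subset_closure => /=.
by rewrite -normr_gt0 (lt_le_trans e0).
Qed.

End CompactSupport.

(** * The set function: monotonicity, finiteness, additivity and regularity *)

Section Measure.
Variables (R : realType) (X : topologicalType).
Hypothesis (lcX : locally_compact [set: X]) (hX : hausdorff_space X).
Variables (B : set (X -> R)) (rho : (X -> R) -> R).
Hypotheses (hCB : @Cc R X `<=` B) (hrho : quasi_linear B rho).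

Let mu := mu_rho rho.
Let mo := mu_open rho.

(** Serves as a substitute for monotonicity of [rho]: [f - g] is nonnegative and [rho] splits on it,
    since [f = 1] wherever [g] is nonzero. *)
Lemma rho_sub f g : Cc f -> Cc g -> (forall x, 0 <= f x <= 1) ->
  (forall x, 0 <= g x <= 1) -> (forall x, g x != 0 -> f x = 1) ->
  rho (f \- g) = rho f - rho g /\ rho g <= rho f.
Proof.
move=> cf cg f01 g01 fg1.
have E : rho (f \- g) = rho f - rho g.
  apply: (quasi_linearB hrho) => //; first exact/hCB/CcD.
    by move=> x; case/andP: (g01 x).
  by move=> x; case/andP: (f01 x).
split => //; rewrite -subr_ge0 -E; apply: (quasi_linear_ge0 hrho).
  exact/hCB/CcB.
move=> x /=; rewrite subr_ge0.
have [->|/fg1 ->] := eqVneq (g x) 0; first by case/andP: (f01 x).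
by case/andP: (g01 x).
Qed.

Local Open Scope ereal_scope.

Lemma le_mu_open f (U : set X) : Cc f -> (forall x, 0 <= f x <= 1)%R ->
  supp f `<=` U -> (rho f)%:E <= mo U.
Proof. by move=> cf f01 fU; apply: ereal_sup_ubound; exists f. Qed.

Lemma mu_open_le (U : set X) z :
  (forall f, Cc f -> (forall x, 0 <= f x <= 1)%R -> supp f `<=` U ->
    (rho f)%:E <= z) -> mo U <= z.
Proof. by move=> H; apply: ge_ereal_sup => _ [f [cf f01 fU] <-]; exact: H. Qed.

Let cst0_01 (x : X) : (0 <= (cst 0 : X -> R) x <= 1)%R.
Proof. by rewrite /= lexx ler01. Qed.

Let supp_cst0 (U : set X) : supp (cst 0%R : X -> R) `<=` U.
Proof.
by apply: subset_trans (@sub0set _ U); apply: supp_subset => //; exact: closed0.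
Qed.

Lemma mu_open_ge0 (U : set X) : 0 <= mo U.
Proof.
have -> : 0 = (rho (cst (0 : R)%R))%:E.
  by rewrite (quasi_linear0 hrho (hCB (@Cc0 R X))).
by apply: le_mu_open => //; exact: Cc0.
Qed.

(** Since the supports are disjoint, [f + g] still takes values in [[0, 1]] and competes in the
    supremum defining [mo W], while [rho] is additive on the pair. *)
Lemma rhoD_le_mu_open f g (W : set X) :
  Cc f -> (forall x, 0 <= f x <= 1)%R -> supp f `<=` W ->
  Cc g -> (forall x, 0 <= g x <= 1)%R -> supp g `<=` W ->
  supp f `&` supp g = set0 -> (rho f)%:E + (rho g)%:E <= mo W.
Proof.
move=> cf f01 fW cg g01 gW fg0.
have {}fg0 x : (f x * g x = 0)%R.
  have [sf|/notin_supp ->] := pselect (supp f x); last by rewrite mul0r.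
  have [sg|/notin_supp ->] := pselect (supp g x); last by rewrite mulr0.
  by have : (supp f `&` supp g) x by []; rewrite fg0.
rewrite -EFinD -(quasi_linearD_disjoint hrho) //.
- apply: le_mu_open; first exact: CcD.
    move=> x /=; have /eqP := fg0 x; rewrite mulf_eq0.
    by move=> /orP[] /eqP ->; rewrite ?add0r ?addr0.
  apply: (@subset_trans _ (supp f `|` supp g)); last by move=> x [/fW|/gW].
  by apply: supp_subset2 => x /= -> ->; rewrite addr0.
- exact/hCB/CcB.
- by move=> x; case/andP: (f01 x).
- by move=> x; case/andP: (g01 x).
Qed.

Lemma subset_mu_open (U V : set X) : U `<=` V -> mo U <= mo V.
Proof.
move=> UV; apply: mu_open_le => f cf f01 fU.
by apply: le_mu_open => // x /fU/UV.
Qed.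

(** The two suprema are taken one after the other, moving the other term across the inequality; this
    requires that term to be finite. *)
Lemma mu_openD_le (U V : set X) z :
  (forall f g, Cc f -> (forall x, 0 <= f x <= 1)%R -> supp f `<=` U ->
     Cc g -> (forall x, 0 <= g x <= 1)%R -> supp g `<=` V ->
     (rho f)%:E + (rho g)%:E <= z) -> mo U + mo V <= z.
Proof.
move=> H; have HV f : Cc f -> (forall x, 0 <= f x <= 1)%R -> supp f `<=` U ->
    (rho f)%:E + mo V <= z.
  move=> cf f01 fU; rewrite addeC -leeBrDr//.
  by apply: mu_open_le => g cg g01 gV; rewrite leeBrDr// addeC; exact: H.
have [Voo|Vfin] := eqVneq (mo V) +oo; last first.
  have {}Vfin : mo V \is a fin_num by rewrite ge0_fin_numE ?mu_open_ge0// ltey.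
  rewrite -leeBrDr//; apply: mu_open_le => f cf f01 fU.
  by rewrite leeBrDr//; exact: HV.
(* With [mo V] infinite, the choice [f = 0] already forces [z = +oo]. *)
have := HV _ (@Cc0 R X) (@cst0_01) (supp_cst0 _).
by rewrite Voo addey// leye_eq => /eqP ->; exact: leey.
Qed.

(** Removes the case distinction between open and other sets, so that monotonicity and positivity
    hold for arbitrary subsets. *)
Lemma mu_rhoE (A : set X) : mu A = mu_closed rho A.
Proof.
rewrite /mu /mu_rho; case: asboolP => // oA.
apply/eqP; rewrite eq_le; apply/andP; split.
  by apply: le_ereal_inf_tmp => _ [U [_ AU] <-]; exact: subset_mu_open.
by apply: ereal_inf_lbound; exists A => //; split.
Qed.

Lemma mu_rho_le (A U : set X) : open U -> A `<=` U -> mu A <= mo U.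
Proof. by move=> oU AU; rewrite mu_rhoE; apply: ereal_inf_lbound; exists U. Qed.

Lemma subset_mu_rho (A A' : set X) : A `<=` A' -> mu A <= mu A'.
Proof.
move=> AA'; rewrite [leRHS]mu_rhoE; apply: le_ereal_inf_tmp => _ [U [oU AU] <-].
by apply: mu_rho_le => //; exact: subset_trans AU.
Qed.

Lemma mu_rho_ge0 (A : set X) : 0 <= mu A.
Proof.
by rewrite mu_rhoE; apply: le_ereal_inf_tmp => _ [U _ <-]; exact: mu_open_ge0.
Qed.

(** Any competitor supported in [V] is nonzero only where [g = 1], so [rho_sub] compares it with
    [g]. *)
Lemma mu_open_le1 g (V : set X) : Cc g -> (forall x, 0 <= g x <= 1)%R ->
  (forall x, V x -> g x = 1%R) -> mo V <= (rho g)%:E.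
Proof.
move=> cg g01 g1; apply: mu_open_le => f cf f01 fV; rewrite lee_fin.
apply: (rho_sub cg cf g01 f01 _).2 => x fx.
by apply/g1/fV; exact: subset_closure.
Qed.

(** With [g] equal to [1] on an open [V] around [K], one gets [mu K <= mo V <= rho g]. *)
Lemma mu_rho_compact_fin_num (K : set X) : compact K -> mu K \is a fin_num.
Proof.
move=> cK; have [g [V [[cg g01 _ oV KV] g1]]] :=
  urysohn_Cc R lcX hX cK openT (@subsetT _ _).
rewrite ge0_fin_numE ?mu_rho_ge0//; apply: le_lt_trans (ltry (rho g)).
exact: le_trans (mu_rho_le oV KV) (mu_open_le1 cg g01 g1).
Qed.

Lemma mu_rho_outer_approx (K O : set X) (e : R) : compact K -> open O ->
  K `<=` O -> (0 < e)%R ->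
  exists U, [/\ open U, K `<=` U, U `<=` O & mo U <= mu K + e%:E].
Proof.
move=> cK oO KO e0; have := mu_rho_compact_fin_num cK.
rewrite !mu_rhoE => /(lb_ereal_inf_adherent e0)[_ [U [oU KU] <-] Ue].
exists (U `&` O); split; [exact: openI| |by move=> x []|].
  by move=> x Kx; split; [exact: KU|exact: KO].
by apply: le_trans (ltW Ue); apply: subset_mu_open => x [].
Qed.

Lemma mu_openU (U V : set X) : open U -> open V -> U `&` V = set0 ->
  mo (U `|` V) = mo U + mo V.
Proof.
move=> oU oV UV0.
have nUV x : U x -> V x -> False.
  by move=> Ux Vx; have : (U `&` V) x by []; rewrite UV0.
apply/eqP; rewrite eq_le; apply/andP; split; last first.
  apply: mu_openD_le => f g cf f01 fU cg g01 gV.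
  apply: rhoD_le_mu_open => //.
  - by move=> x /fU Ux; left.
  - by move=> x /gV Vx; right.
  - by apply/seteqP; split => // x [/fU Ux /gV Vx]; exact: (nUV x).
apply: mu_open_le => h ch h01 hUV.
(* What [supp h] leaves outside [V] is compact and contained in [U]. A Urysohn function [g] for it
   makes [h g] equal to [h] on [U] and [0] elsewhere, so [h g] and [h - h g] are the pieces of [h]
   on [U] and [V]. *)
have cK : compact (supp h `&` ~` V).
  by apply: compact_closedI; [case: ch|exact: open_closedC].
have KU : supp h `&` ~` V `<=` U by move=> x [/hUV[]].
have [g [W [[cg g01 gU oW KW] g1]]] := urysohn_Cc R lcX hX cK oU KU.
have ghU x : U x -> (h x * g x = h x)%R.
  move=> Ux; have [hx|/notin_supp ->] := pselect (supp h x);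
    last by rewrite mul0r.
  by rewrite g1 ?mulr1//; apply: KW; split => // Vx; exact: (nUV x).
have ghNU x : ~ U x -> (h x * g x = 0)%R.
  move=> nUx; rewrite [g x](notin_supp (x := x)) ?mulr0//.
  by move=> /gU.
have hE : h = ((h \* g) \+ (h \- (h \* g)))%R.
  by apply/funext => x /=; rewrite addrC subrK.
have chg : Cc (h \* g)%R by exact: CcM.
have h0 x : (0 <= h x)%R by case/andP: (h01 x).
rewrite [in X in (rho X)]hE (quasi_linearD_disjoint hrho) ?EFinD.
- apply: leeD; apply: le_mu_open => //.
  + move=> x /=; have [/ghU ->//|/ghNU ->] := pselect (U x).
    by rewrite lexx ler01.
  + apply: subset_trans gU; apply: supp_subset; first exact: closed_closure.
    by move=> x /notin_supp /= ->; rewrite mulr0.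
  + exact: CcB.
  + move=> x /=; have [/ghU ->|/ghNU ->] := pselect (U x); last by rewrite subr0.
    by rewrite subrr lexx ler01.
  + apply: (@subset_trans _ (supp h `&` ~` U)) => [|x [/hUV[]]]//.
    apply: supp_subset.
      by apply: closedI; [exact: closed_closure|exact: open_closedC].
    move=> x /not_andP[/notin_supp /= ->|/contrapT /ghU /= ->].
      by rewrite mul0r subrr.
    by rewrite subrr.
- by apply/hCB/CcB => //; exact: CcB.
- by move=> x /=; have [/ghU ->//|/ghNU ->] := pselect (U x).
- move=> x /=; have [/ghU ->|/ghNU ->] := pselect (U x).
    by rewrite subrr.
  by rewrite subr0.
- move=> x /=; have [/ghU ->|/ghNU ->] := pselect (U x).
    by rewrite subrr mulr0.
  by rewrite mul0r.
Qed.

Lemma mu_open_cut (K W : set X) : compact K -> open W -> K `<=` W ->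
  mo W = mu K + mo (W `&` ~` K).
Proof.
move=> cK oW KW; have clK := compact_closed hX cK.
have oWK : open (W `&` ~` K) by apply: openI => //; exact: closed_openC.
apply/eqP; rewrite eq_le; apply/andP; split.
  apply: mu_open_le => f cf f01 fW; apply/lee_addgt0Pr => e e0.
  (* Let [g] be a Urysohn function for [K] in a nearly optimal [U], and [k] one for [supp f] and
     [supp g] together in [W]. Then [rho f <= rho k = rho g + rho (k - g)], with [rho g <= mo U]. *)
  have [U [oU KU UW Ue]] := mu_rho_outer_approx cK oW KW e0.
  have [g [V [[cg g01 gU oV KV] g1]]] := urysohn_Cc R lcX hX cK oU KU.
  have cfg : compact (supp f `|` supp g).
    by apply: compactU; [case: cf|case: cg].
  have fgW : supp f `|` supp g `<=` W by move=> x [/fW|/gU/UW].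
  have [k [V' [[ck k01 kW oV' fgV'] k1]]] := urysohn_Cc R lcX hX cfg oW fgW.
  have kf x : f x != 0%R -> k x = 1%R.
    by move=> fx; apply/k1/fgV'; left; exact: subset_closure.
  have kg x : g x != 0%R -> k x = 1%R.
    by move=> gx; apply/k1/fgV'; right; exact: subset_closure.
  have [_ fk] := rho_sub ck cf k01 f01 kf.
  have [kgE _] := rho_sub ck cg k01 g01 kg.
  apply: (@le_trans _ _ ((rho g)%:E + (rho (k \- g)%R)%:E)).
    by rewrite -EFinD lee_fin kgE addrC subrK.
  rewrite addeAC; apply: leeD.
    exact: le_trans (le_mu_open cg g01 gU) Ue.
  apply: le_mu_open; first exact: CcB.
    move=> x /=; have [->|gx] := eqVneq (g x) 0%R; first by rewrite subr0.
    by rewrite (kg x gx) subr_ge0 lerBlDr lerDl andbC; exact: g01.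
  (* On [V] both [k] and [g] are [1], so [k - g] is supported away from [V], hence away from [K]. *)
  apply: (@subset_trans _ (supp k `&` ~` V)).
    apply: supp_subset.
      by apply: closedI; [exact: closed_closure|exact: open_closedC].
    move=> x nx; have [Vx|nVx] /= := pselect (V x).
      by rewrite kg ?g1 ?oner_eq0// subrr.
    have kx : k x = 0%R by apply: notin_supp => ?; apply: nx.
    have [->|/kg E] := eqVneq (g x) 0%R; first by rewrite kx subr0.
    by move: E; rewrite kx => /esym/eqP; rewrite oner_eq0.
  by move=> x [/kW Wx nVx]; split => // /KV.
rewrite -leeBrDl ?mu_rho_compact_fin_num//.
apply: mu_open_le => f cf f01 fWK; rewrite leeBrDl ?mu_rho_compact_fin_num//.
(* For the reverse inequality, a Urysohn function for [K] off [supp f] dominates [mu K] and has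
   support disjoint from that of [f]. *)
have oWf : open (W `&` ~` supp f).
  by apply: openI => //; apply: closed_openC; exact: closed_closure.
have KWf : K `<=` W `&` ~` supp f.
  by move=> x Kx; split; [exact: KW|move=> /fWK[]].
have [g [V [[cg g01 gU oV KV] g1]]] := urysohn_Cc R lcX hX cK oWf KWf.
apply: (@le_trans _ _ ((rho g)%:E + (rho f)%:E)).
  apply: leeD => //; apply: le_trans (mu_rho_le oV KV) _.
  exact: mu_open_le1.
apply: rhoD_le_mu_open => //.
- by move=> x /gU[].
- by move=> x /fWK[].
- by apply/seteqP; split => // x [/gU[]].
Qed.

(** Reduces to [mu_openU] through disjoint open [U] and [V] around [K] and [L]: near-optimal
    neighbourhoods are taken inside them for one inequality, and any neighbourhood [W] of the union
    is intersected with them for the other. *)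
Lemma mu_rho_compactU (K L : set X) : compact K -> compact L ->
  K `&` L = set0 -> mu (K `|` L) = mu K + mu L.
Proof.
move=> cK cL KL0.
have [U [V [oU oV KU LV UV0]]] := separate_compact R lcX hX cK cL KL0.
have UV0S (U' V' : set X) : U' `<=` U -> V' `<=` V -> U' `&` V' = set0.
  move=> UU VV; apply/seteqP; split => // x [/UU Ux /VV Vx].
  by rewrite -UV0.
apply/eqP; rewrite eq_le; apply/andP; split.
  apply/lee_addgt0Pr => e e0; have e20 : (0 < e / 2)%R by rewrite divr_gt0.
  have [U' [oU' KU' UU Ue]] := mu_rho_outer_approx cK oU KU e20.
  have [V' [oV' LV' VV Ve]] := mu_rho_outer_approx cL oV LV e20.
  apply: (@le_trans _ _ (mo (U' `|` V'))).
    by apply: mu_rho_le; [exact: openU|exact: setUSS].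
  rewrite mu_openU//; last exact: UV0S.
  by rewrite [e in leRHS]splitr EFinD addeACA; exact: leeD.
rewrite [leRHS]mu_rhoE; apply: le_ereal_inf_tmp => _ [W [oW KLW] <-].
apply: (@le_trans _ _ (mo (W `&` U) + mo (W `&` V))).
  apply: leeD; apply: mu_rho_le; try exact: openI.
    by move=> x Kx; split; [apply: KLW; left|exact: KU].
  by move=> x Lx; split; [apply: KLW; right|exact: LV].
rewrite -mu_openU; [|exact: openI|exact: openI|].
  by apply: subset_mu_open => x [[]|[]].
by apply: UV0S => x [].
Qed.

(* When [C `|` U] is compact with open neighbourhood [W], the set [W `\` C]
   splits into the open sets [U] and [W `\` (C `|` U)]; cutting [W] along [C]
   and along [C `|` U] and cancelling the common finite term gives the claim. *)
Lemma mu_rho_compact_openU (C U : set X) : compact C -> open U ->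
  C `&` U = set0 -> compact (C `|` U) -> mu (C `|` U) = mu C + mo U.
Proof.
move=> cC oU CU0 cK; set K := C `|` U.
have [W [D [oW cD KW WD]]] := open_precompact_nbhs R lcX hX cK.
have CW : C `<=` W by move=> x Cx; apply: KW; left.
have oWK : open (W `&` ~` K).
  by apply: openI => //; exact/closed_openC/(compact_closed hX).
have WCE : W `&` ~` C = U `|` (W `&` ~` K).
  apply/seteqP; split => x.
    move=> [Wx nCx]; have [Ux|nUx] := pselect (U x); [by left|right].
    by split => // -[].
  move=> [Ux|[Wx nKx]]; last by split => // Cx; apply: nKx; left.
  split; first by apply: KW; right.
  by move=> Cx; have : (C `&` U) x by []; rewrite CU0.
have UWK0 : U `&` (W `&` ~` K) = set0.
  by apply/seteqP; split => // x [Ux [_]]; apply; right.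
(* Finiteness comes from the choice of [W] inside the compact [D]. *)
have finWK : mo (W `&` ~` K) \is a fin_num.
  rewrite ge0_fin_numE ?mu_open_ge0//.
  have DWK : mo (W `&` ~` K) <= mu D.
    rewrite -[leLHS](mu_rho_openE rho oWK).
    by apply: subset_mu_rho => x [/WD].
  apply: le_lt_trans DWK _.
  by rewrite -ge0_fin_numE ?mu_rho_ge0//; exact: mu_rho_compact_fin_num.
have := mu_open_cut cK oW KW.
rewrite (mu_open_cut cC oW CW) WCE (mu_openU oU oWK UWK0) addeA.
by move=> /(congr1 (fun z => z - mo (W `&` ~` K))); rewrite !addeK.
Qed.

(** When the union is open, it can itself be cut along [C] by [mu_open_cut], and what remains is
    [U]. *)
Lemma mu_rhoU_compact_open (C U : set X) : compact C -> open U ->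
  C `&` U = set0 -> compact (C `|` U) \/ open (C `|` U) ->
  mu (C `|` U) = mu C + mu U.
Proof.
move=> cC oU CU0; rewrite [mu U]mu_rho_openE// => -[cCU|oCU].
  exact: mu_rho_compact_openU.
rewrite [LHS]mu_rho_openE//.
apply: (etrans (mu_open_cut cC oCU (@subsetUl _ C U))).
rewrite (_ : (C `|` U) `&` ~` C = U)//; apply/seteqP; split => x.
  by move=> [[]].
move=> Ux; split; first by right.
by move=> Cx; have : (C `&` U) x by []; rewrite CU0.
Qed.

Lemma mu_rho_topological_measure : topological_measure mu.
Proof.
split.
- by move=> A _; exact: mu_rho_ge0.
- exists set0; first by right; exact: closed0.
  by have := mu_rho_compact_fin_num (@compact0 X); rewrite fin_numE => /andP[].
- move=> A A' AA'0 [cA|oA] [cA'|oA'] cAA'.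
  + exact: mu_rho_compactU.
  + exact: mu_rhoU_compact_open.
  + rewrite setUC addeC; apply: mu_rhoU_compact_open; rewrite 1?setIC//.
    by rewrite setUC.
  + by rewrite /mu !mu_rho_openE//; [exact: mu_openU|exact: openU].
- move=> U oU; apply/eqP; rewrite eq_le; apply/andP; split; last first.
    by apply: ge_ereal_sup => _ [K [cK KU] <-]; exact: subset_mu_rho.
  rewrite /mu mu_rho_openE//; apply: mu_open_le => f cf f01 fU.
  (* The compact set [supp f] witnesses inner regularity: [f] competes for every open set containing
     it, so [rho f <= mu (supp f)]. *)
  apply: (@le_trans _ _ (mu (supp f))); last first.
    by apply: ereal_sup_ubound; exists (supp f) => //; split => //; case: cf.
  rewrite mu_rhoE; apply: le_ereal_inf_tmp => _ [V [oV fV] <-].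
  exact: le_mu_open.
- move=> F cF; rewrite mu_rhoE /mu_closed; congr ereal_inf.
  by apply/seteqP; split => _ [U [oU FU] <-]; exists U => //;
    rewrite [mu U]mu_rho_openE.
Qed.

Lemma mu_rho_le_norm : mu [set: X] <= ql_norm B rho.
Proof.
rewrite /mu mu_rho_openE; last exact: openT.
apply: mu_open_le => f cf f01 _; apply: ereal_sup_ubound.
by exists f => //; split => //; exact: hCB.
Qed.

End Measure.

Local Open Scope ereal_scope.

Theorem theorem37 (R : realType) (X : topologicalType)
    (lcX : locally_compact [set: X])
    (hX : hausdorff_space X)
    (cX : connected [set: X])
    (B : set (X -> R)) (hB : B = @C0 R X \/ B = @Cc R X)
    (rho : (X -> R) -> R) (hrho : quasi_linear B rho) :
  (topological_measure (mu_rho rho) /\ tm_compact_finite (mu_rho rho)) /\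
  (ql_norm B rho < +oo ->
     tm_finite (mu_rho rho) /\ mu_rho rho [set: X] <= ql_norm B rho).
Proof.
have CcB : @Cc R X `<=` B by case: hB => ->; [exact: Cc_C0|].
have mule := mu_rho_le_norm rho CcB.
split; last by move=> rhofin; split => //; exact: le_lt_trans rhofin.
split; first exact: mu_rho_topological_measure CcB hrho.
move=> K cK; have := mu_rho_compact_fin_num lcX hX CcB hrho cK.
by rewrite fin_numE ltey => /andP[].
Qed.
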